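(* Assume that $\mathrm{MA(countable)}$ holds. Then there exists an ultrafilter $\mathcal{U}\subseteq 2^\omega$ on $\omega$ that is not a $\mathrm{P}$-point and is not countable dense homogeneous.
   Context: Every subset of $\omega$ is identified with its characteristic function, so an ultrafilter on $\omega$ is regarded as a subset of the Cantor set $2^\omega$ and carries the subspace topology. For $x,y\subseteq\omega$, $x\subseteq^\ast y$ means that $x\setminus y$ is finite; a pseudointersection of $\mathcal{C}\subseteq\mathcal{P}(\omega)$ is a set $x\subseteq\omega$ such that $x\subseteq^\ast y$ for all $y\in\mathcal{C}$. A $\mathrm{P}$-point is a non-principal ultrafilter $\mathcal{U}$ on $\omega$ such that every countable $\mathcal{C}\subseteq\mathcal{U}$ has a pseudointersection in $\mathcal{U}$. A (separable metrizable) space $X$ is countable dense homogeneous if for every pair $(D,E)$ of countable dense subsets of $X$ there exists a homeomorphism $f:X\to X$ such that $f[D]=E$. $\mathrm{MA(countable)}$ (Martin's Axiom for countable posets) is the statement: for every non-empty countable partially ordered set $\mathbb{P}$ and every collection $\mathcal{D}$ of dense subsets of $\mathbb{P}$ with $|\mathcal{D}|<\mathfrak{c}=2^{\aleph_0}$, there is a filter $G\subseteq\mathbb{P}$ that meets every element of $\mathcal{D}$. *)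

(* Defs.v *)
From HB Require Import structures.
From mathcomp Require Import all_boot all_order.
From mathcomp Require Import boolp classical_sets functions cardinality filter.
From mathcomp Require Import topology cantor.

Set Implicit Arguments.
Unset Strict Implicit.
Unset Printing Implicit Defensive.

Local Open Scope classical_set_scope.
Local Open Scope card_scope.

Definition card_lt T U (A : set T) (B : set U) : Prop :=
  A #<= B /\ ~ (A #= B).

(** Order-theoretic notions with the forcing convention: [q <= p] means that
    [q] extends [p]. *)
Definition order_dense d (P : porderType d) (D : set P) : Prop :=
  forall p, exists2 q, D q & (q <= p)%O.

Record order_filter d (P : porderType d) (G : set P) : Prop := OrderFilter {
  order_filter_nonempty : G !=set0 ;
  order_filter_up : forall p q, G p -> (p <= q)%O -> G q ;
  order_filter_directed : forall p q, G p -> G q ->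
    exists2 r, G r & (r <= p)%O /\ (r <= q)%O
}.

(** Martin's Axiom for countable posets; [set: cantor_space] has cardinality
    the continuum. *)
Definition MA_countable : Prop :=
  forall (d : Order.disp_t) (P : porderType d) (DD : set (set P)),
    [set: P] !=set0 -> countable [set: P] ->
    (forall D, DD D -> order_dense D) ->
    card_lt DD [set: cantor_space] ->
    exists2 G : set P, order_filter G & forall D, DD D -> G `&` D !=set0.

Definition almost_subset (x y : set nat) : Prop := finite_set (x `\` y).

Definition pseudointersection (C : set_system nat) (x : set nat) : Prop :=
  forall y, C y -> almost_subset x y.

Definition P_point (U : set_system nat) : Prop :=
  [/\ UltraFilter U,
      forall n : nat, U <> principal_filter n &
      forall C : set_system nat, countable C -> C `<=` U ->
        exists2 x, U x & pseudointersection C x].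

(** A family of subsets of [nat], as a set of characteristic functions. Its
    coercion to a type carries the subspace topology. *)
Definition char_funs (U : set_system nat) : set cantor_space :=
  [set x | U [set n | x n]].

Definition homeomorphism (X Y : topologicalType) (f : X -> Y) : Prop :=
  continuous f /\
  exists g : Y -> X, [/\ continuous g, cancel f g & cancel g f].

(** Usually considered for separable metrizable [X], which holds for every
    subspace of [cantor_space]. *)
Definition countable_dense_homogeneous (X : topologicalType) : Prop :=
  forall D E : set X, countable D -> dense D -> countable E -> dense E ->
    exists2 f : X -> X, homeomorphism f & f @` D = E.

(* Main.v *)
Require Import Defs.
From HB Require Import structures.
From mathcomp Require Import all_boot all_order.
From mathcomp Require Import boolp classical_sets functions cardinality filter.
From mathcomp Require Import topology cantor wochoice.

Set Implicit Arguments.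
Unset Strict Implicit.
Unset Printing Implicit Defensive.

Local Open Scope classical_set_scope.
Local Open Scope card_scope.

(** Fix a countable independent family of subsets of [nat], split into two
    halves [D1] and [D2] that are both dense in the Cantor space: it is
    [indep_real], indexed by labels whose boolean tells the half and whose
    finite sequence is an initial segment of the set.  The ultrafilter [U] is
    made to contain this family, and also the complement of each of its
    pseudointersections.  The first property gives a countable subfamily of
    [U], the second one says that it has no pseudointersection in [U], so [U]
    is not a P-point ([not_P_point]).  Since [D1] and [D2] are dense in [U], it
    remains to ensure that no homeomorphism of [U] maps [D1] onto [D2].

    A homeomorphism [f] with [f(D1) = D2] induces an injection [phi] of the
    index set of [D1] into that of [D2], and continuity of [f] makes [phi]
    [tame].  There are only continuum many [phi], and each of them is defeated
    by one set [u] put in [U]: let [x] be a real and let [z] be a set of [k]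
    such that all points of [D1] close enough to [x], depending on [k], have
    images under [phi] that omit [k].  If [u] is contained in [x] and in [z],
    then [x] is in [U], and [f(x)] is a limit of such images, so that [f(x)] is
    disjoint from [z]; thus two disjoint sets belong to [U], which is absurd
    ([not_homogeneous]).

    The sets [u] are found by a recursion of length continuum, along which they
    stay independent of the fixed family: any finite intersection of them meets
    every finite Boolean combination of the fixed family in an infinite set.
    At each stage the real [x] is a Cohen real over fewer than continuum many
    dense sets, given by Martin's Axiom ([MA_obstruction]).  The dense sets are
    met because a point [d] of [D1] extending a given finite condition can be
    chosen so that neither [d] nor its image [e] occurs in a given finite Boolean
    combination.  Independence then yields large [k] in [d] and outside [e] that
    belong to this combination and to a given finite intersection, and tameness
    gives a finite piece of [d] all of whose extensions in [D1] have images that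
    omit [k].

    That there are fewer than continuum many dense sets rests on the fact that
    an infinite set has as many finite sequences as elements
    ([card_setX_infinite], [card_seqX_le]) and on a well-order of the continuum
    whose proper initial segments are small ([exists_initial_well_order]). *)

(** * Comparison of cardinals *)

(** Avoiding an explicit function keeps the choice of default values out of
    the comparisons below. *)
Lemma card_le_rel T U (A : set T) (B : set U) (G : T -> U -> Prop) :
  (forall x, A x -> exists2 y, B y & G x y) ->
  (forall x x' y, A x -> A x' -> G x y -> G x' y -> x = x') ->
  A #<= B.
Proof.
move=> totG injG.
have /choice[f fG] (x : A) : exists y : B, G (\val x) (\val y).
  have [y By Gxy] := totG _ (set_mem (valP x)).
  by exists (SigSub (mem_set By)).
apply/card_leP/injfunPex; exists f => // x x' _ _ fxx'; apply: val_inj.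
apply: (injG _ _ (\val (f x))) => //; last by rewrite fxx'.
- exact: set_mem (valP x).
- exact: set_mem (valP x').
Qed.

Lemma card_le_fun T (U : pointedType) (A : set T) (B : set U) :
  A #<= B -> exists2 f : T -> U, (forall x, A x -> B (f x)) &
    (forall x y, A x -> A y -> f x = f y -> x = y).
Proof.
move=> /pcard_leP/injfunPex[f fAB finj]; exists f => //.
by move=> x y Ax Ay; apply: finj; exact: mem_set.
Qed.

(** A maximal partial injection from [A] to [B] is total or surjective: else it
    extends by one pair. *)
Lemma card_le_total T U (A : set T) (B : set U) : A #<= B \/ B #<= A.
Proof.
pose P (G : set (T * U)) :=
  [/\ forall x y, G (x, y) -> A x /\ B y,
      forall x y y', G (x, y) -> G (x, y') -> y = y' &
      forall x x' y, G (x, y) -> G (x', y) -> x = x'].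
have [F FP Ftot|G [[GAB Gfun Ginj] Gmax]] := @Zorn_bigcup _ P.
  have common p q : (\bigcup_(X in F) X) p -> (\bigcup_(X in F) X) q ->
      exists2 X, F X & X p /\ X q.
    move=> [X FX Xp] [Y FY Yq].
    by case: (Ftot X Y FX FY) => XY; [exists Y|exists X] => //; split=> //; exact: XY.
  split.
  - by move=> x y [X /FP[+ _ _] Xxy] => /(_ _ _ Xxy).
  - move=> x y y' Gy Gy'; have [X /FP[_ + _] []] := common _ _ Gy Gy'.
    exact.
  - move=> x x' y Gy Gy'; have [X /FP[_ _ +] []] := common _ _ Gy Gy'.
    exact.
have [totA|/existsNP[x]] :=
    pselect (forall x, A x -> exists2 y, B y & G (x, y)).
  by left; apply: card_le_rel totA _ => x x' y _ _; exact: Ginj.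
move=> /not_implyP[Ax noy].
have [totB|/existsNP[y]] :=
    pselect (forall y, B y -> exists2 x, A x & G (x, y)).
  right; apply: (card_le_rel (G := fun y x => G (x, y))) totB _ => y y' z _ _.
  exact: Gfun.
move=> /not_implyP[By nox]; exfalso.
apply: (Gmax (G `|` [set (x, y)])).
  rewrite properEneq; split; last by left.
  apply/eqP => GE; apply: noy; exists y => //.
  by rewrite GE; right.
split.
- by move=> x' y' [/GAB//|[-> ->]].
- move=> x' y1 y2 [G1|[E1 F1]] [G2|[E2 F2]]; rewrite ?F1 ?F2 //.
  + exact: Gfun G1 G2.
  + by case: noy; exists y1; rewrite -?E2 //; have [] := GAB _ _ G1.
  + by case: noy; exists y2; rewrite -?E1 //; have [] := GAB _ _ G2.
- move=> x1 x2 y' [G1|[E1 F1]] [G2|[E2 F2]]; rewrite ?E1 ?E2 //.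
  + exact: Ginj G1 G2.
  + by case: nox; exists x1; rewrite -?F2 //; have [] := GAB _ _ G1.
  + by case: nox; exists x2; rewrite -?F1 //; have [] := GAB _ _ G2.
Qed.

(** * Squares and finite sequences of an infinite set *)

Section Square.
Variables (T : pointedType) (A : set T).

(** A pairing below is the graph of an injection of [X `*` X] into [X], where [X]
    is read off the diagonal of the graph.  With this encoding all conditions
    involve at most two elements of the graph, so they pass to unions of
    chains. *)
Definition support_of (G : set ((T * T) * T)) : set T :=
  [set a | A a /\ exists c, G ((a, a), c)].

Record pairing (G : set ((T * T) * T)) : Prop := Pairing {
  pairing_fun : forall u c c', G (u, c) -> G (u, c') -> c = c' ;
  pairing_inj : forall u v c, G (u, c) -> G (v, c) -> u = v ;
  pairing_diag : forall a b c, G ((a, b), c) ->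
    [/\ support_of G a, support_of G b & support_of G c] ;
  pairing_tot : forall a b, support_of G a -> support_of G b ->
    exists c, G ((a, b), c)
}.

Lemma support_ofS G H : G `<=` H -> support_of G `<=` support_of H.
Proof. by move=> GH a [Aa [c Gc]]; split=> //; exists c; exact: GH. Qed.

Lemma pairing_union G :
  (forall p q, G p -> G q ->
     exists2 K, pairing K & [/\ K `<=` G, K p & K q]) ->
  pairing G.
Proof.
move=> dirG; split.
- move=> u c c' Gc Gc'; have [K pK [_ Kc Kc']] := dirG _ _ Gc Gc'.
  exact: pairing_fun Kc Kc'.
- move=> u v c Gu Gv; have [K pK [_ Ku Kv]] := dirG _ _ Gu Gv.
  exact: pairing_inj Ku Kv.
- move=> a b c Gc; have [K pK [KG Kc _]] := dirG _ _ Gc Gc.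
  have [Ka Kb Kc'] := pairing_diag pK Kc.
  by split; exact: support_ofS Ka || exact: support_ofS Kb || exact: support_ofS Kc'.
- move=> a b [Aa [c Gc]] [Ab [c' Gc']].
  have [K pK [KG Kc Kc']] := dirG _ _ Gc Gc'.
  have [||e Ke] := pairing_tot pK (a := a) (b := b).
  + by split=> //; exists c.
  + by split=> //; exists c'.
  by exists e; exact: KG.
Qed.

Lemma pairing_nat (f : nat -> T) : (forall n, A (f n)) -> injective f ->
  pairing [set p | exists nm : nat * nat, p = ((f nm.1, f nm.2), f (pickle nm))].
Proof.
move=> fA finj; set G := (X in pairing X).
have supportE n : support_of G (f n).
  by split=> //; exists (f (pickle (n, n))); exists (n, n).
split.
- by move=> u c c' [[n m] [-> ->]] [[n' m'] /= [/finj -> /finj -> ->]].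
- move=> u v c [nm [-> ->]] [nm' [-> /finj/(pcan_inj pickleK) ->]] //.
- by move=> a b c [[n m] /= [-> -> ->]].
- move=> a b [_ [c [[n m] /= [-> _ _]]]] [_ [c' [[n' m'] /= [-> _ _]]]].
  by exists (f (pickle (n, n'))), (n, n').
Qed.

(** If a disjoint copy [h(X)] of the support [X] is available, a pairing of [X]
    extends to the union of [X] and [h(X)].  The three new quarters of the
    square of this union are injected into [h(X)], each with its own tag [t]. *)
Lemma pairing_extend (G : set ((T * T) * T)) (t : bool * bool -> T) (h : T -> T) :
  pairing G -> (forall e, support_of G (t e)) -> injective t ->
  (forall x, support_of G x -> A (h x) /\ ~ support_of G (h x)) ->
  (forall x y, support_of G x -> support_of G y -> h x = h y -> x = y) ->
  exists2 H, pairing H & G `<` H.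
Proof.
move=> pG tX tinj hX hinj; set X := support_of G in tX hX hinj *.
have /choice[p pE] (u : T * T) :
    exists c, X u.1 -> X u.2 -> G (u, c).
  have [[X1 X2]|nX] := pselect (X u.1 /\ X u.2); last by exists point => *; case: nX.
  by case: u X1 X2 => a b /= X1 X2; have [c] := pairing_tot pG X1 X2; exists c.
have pX a b : X a -> X b -> X (p (a, b)).
  by move=> Xa Xb; have [] := pairing_diag pG (pE (a, b) Xa Xb).
have pinj a b a' b' : X a -> X b -> X a' -> X b' ->
    p (a, b) = p (a', b') -> a = a' /\ b = b'.
  move=> Xa Xb Xa' Xb' e.
  have := pE (a, b) Xa Xb; rewrite e => /(pairing_inj pG) /(_ (pE (a', b') Xa' Xb')).
  by case.
pose e (b : bool) x := if b then h x else x.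
have einj b b' x x' : X x -> X x' -> e b x = e b' x' -> b = b' /\ x = x'.
  move=> Xx Xx'; case: b b' => -[] /= E; split=> //.
  - exact: hinj.
  - by have [_ []] := hX _ Xx; rewrite E.
  - by have [_ []] := hX _ Xx; rewrite E.
  - by have [_ []] := hX _ Xx'; rewrite -E.
  - by have [_ []] := hX _ Xx'; rewrite -E.
pose code b1 b2 x y := h (p (t (b1, b2), p (x, y))).
pose N : set ((T * T) * T) := [set q | exists b1 b2 x y,
  [/\ b1 || b2, X x, X y & q = ((e b1 x, e b2 y), code b1 b2 x y)]].
have XA x : X x -> A x by case.
have eA b x : X x -> A (e b x) by case: b => //= [/hX[]|/XA].
have codeX b1 b2 x y : X x -> X y -> X (p (t (b1, b2), p (x, y))).
  by move=> Xx Xy; exact: pX (tX _) (pX _ _ Xx Xy).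
have supportE b x : X x -> support_of (G `|` N) (e b x).
  move=> Xx; split; first exact: eA.
  case: b => /=; last by have [_ [c Gc]] := Xx; exists c; left.
  by exists (code true true x x); right; exists true, true, x, x.
have supportP a : support_of (G `|` N) a -> exists b x, X x /\ a = e b x.
  move=> [Aa [c [Gc|[b1 [b2 [x [y [_ Xx Xy [-> _ _]]]]]]]]].
    by exists false, a; split=> //; split=> //; exists c.
  by exists b1, x.
have GNfun u c c' : G (u, c) -> ~ N (u, c').
  case: u => a b /(pairing_diag pG)[Xa Xb _] [b1 [b2 [x [y [+ Xx Xy [E1 E2 _]]]]]].
  by case: b1 b2 E1 E2 => -[] //= E1 E2 _;
    [have [_ []] := hX _ Xx; rewrite -E1|have [_ []] := hX _ Xx; rewrite -E1|
     have [_ []] := hX _ Xy; rewrite -E2].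
have GNinj u v c : G (u, c) -> ~ N (v, c).
  case: u => a b /(pairing_diag pG)[_ _ Xc] [b1 [b2 [x [y [_ Xx Xy [_ E]]]]]].
  by have [_ []] := hX _ (codeX b1 b2 _ _ Xx Xy); rewrite -/(code b1 b2 x y) -E.
exists (G `|` N); last first.
  rewrite properEneq; split; last by left.
  apply/eqP => GE.
  have Xt := tX (true, true).
  have [_ []] := hX _ Xt.
  by have := supportE true _ Xt; rewrite -GE.
split.
- move=> u c c' [Gc|Nc] [Gc'|Nc'].
  + exact: pairing_fun Gc Gc'.
  + by have := GNfun _ _ _ Gc Nc'.
  + by have := GNfun _ _ _ Gc' Nc.
  + move: Nc Nc' => [b1 [b2 [x [y [_ Xx Xy [-> ->]]]]]].
    move=> [b1' [b2' [x' [y' [_ Xx' Xy' [+ + ->]]]]]].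
    by move=> /(einj _ _ _ _ Xx Xx')[-> ->] /(einj _ _ _ _ Xy Xy')[-> ->].
- move=> u v c [Gu|Nu] [Gv|Nv].
  + exact: pairing_inj Gu Gv.
  + by have := GNinj _ _ _ Gu Nv.
  + by have := GNinj _ _ _ Gv Nu.
  + move: Nu Nv => [b1 [b2 [x [y [_ Xx Xy [-> ->]]]]]].
    move=> [b1' [b2' [x' [y' [_ Xx' Xy' [-> +]]]]]].
    move=> /(hinj _ _ (codeX _ _ _ _ Xx Xy) (codeX _ _ _ _ Xx' Xy')).
    move=> /(pinj _ _ _ _ (tX _) (pX _ _ Xx Xy) (tX _) (pX _ _ Xx' Xy')).
    by move=> [/tinj[-> ->] /(pinj _ _ _ _ Xx Xy Xx' Xy')[-> ->]].
- move=> a b c [/(pairing_diag pG)[Ga Gb Gc]|].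
    by split; apply: support_ofS; first [exact: Ga|exact: Gb|exact: Gc|left].
  move=> [b1 [b2 [x [y [_ Xx Xy [-> -> ->]]]]]].
  by split; [exact: supportE|exact: supportE|exact:
    (supportE true _ (codeX _ _ _ _ Xx Xy))].
- move=> _ _ /supportP[b1 [x [Xx ->]]] /supportP[b2 [y [Xy ->]]].
  have [b12|] := boolP (b1 || b2).
    by exists (code b1 b2 x y); right; exists b1, b2, x, y.
  rewrite negb_or => /andP[/negbTE -> /negbTE ->] /=.
  by have [c Gc] := pairing_tot pG Xx Xy; exists c; left.
Qed.

End Square.

(** Zorn's lemma gives a maximal pairing with infinite support [X].  Were [X] to
    inject into the rest of [A], the pairing would extend; so the rest of [A]
    injects into [X], and [A] injects into two copies of [X], hence into
    [X]. *)
Lemma card_setX_infinite (T : pointedType) (A : set T) :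
  infinite_set A -> A `*` A #<= A.
Proof.
move=> /infiniteP/card_le_fun[f fA finj].
have {}finj : injective f by move=> n m; exact: finj.
have {}fA n : A (f n) by exact: fA.
(* Every graph is required to contain [G0], so that its support is infinite. *)
set G0 := [set p | exists nm : nat * nat,
  p = ((f nm.1, f nm.2), f (pickle nm))].
have pG0 : pairing A G0 by exact: pairing_nat.
have [F FP Ftot|G [pG Gmax]] :=
    @Zorn_bigcup _ [set G | pairing A (G `|` G0)].
  apply: pairing_union => q r [[X FX Xq]|G0q] [[Y FY Yr]|G0r].
  - have [XY|YX] := Ftot X Y FX FY.
      exists (Y `|` G0); first exact: FP.
      split; [by apply: setSU; exact: bigcup_sup|by left; exact: XY|by left].
    exists (X `|` G0); first exact: FP.
    split; [by apply: setSU; exact: bigcup_sup|by left|by left; exact: YX].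
  - exists (X `|` G0); first exact: FP.
    by split; [apply: setSU; exact: bigcup_sup|left|right].
  - exists (Y `|` G0); first exact: FP.
    by split; [apply: setSU; exact: bigcup_sup|right|left].
  - by exists G0 => //; split.
rewrite /= in pG; set H := G `|` G0 in pG.
pose t (b : bool * bool) := f (pickle b).
have fX n : support_of A H (f n).
  by split=> //; exists (f (pickle (n, n))); right; exists (n, n).
have tinj : injective t by move=> b b' /finj/(pcan_inj pickleK).
have XX : support_of A H `*` support_of A H #<= support_of A H.
  apply: (card_le_rel (G := fun u c => H (u, c))) => [[a b] [/= Xa Xb]|u v c _ _].
    have [c Hc] := pairing_tot pG Xa Xb; exists c => //.
    by have [] := pairing_diag pG Hc.
  exact: (pairing_inj pG).
have [|] := card_le_total (support_of A H) (A `\` support_of A H).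
  move=> /card_le_fun[h hX hinj].
  have [||K pK HK] := @pairing_extend _ A H t h pG (fun b => fX _) tinj.
  - by move=> x /hX[].
  - exact: hinj.
  have HK0 := properW HK.
  have [] := Gmax K.
    rewrite properEneq; split; last by move=> q Gq; apply: HK0; left.
    apply/eqP => GK; move: HK; rewrite properEneq => -[/eqP HK _]; apply: HK.
    by rewrite eqEsubset; split=> // q; rewrite -GK; left.
  rewrite /= (_ : K `|` G0 = K) //; apply: setUidl.
  by move=> q G0q; apply: HK0; right.
move=> /card_le_fun[h hX hinj].
have [p pX pinj] := card_le_fun XX.
have [g gX ginj] : exists2 g : T -> T, (forall x, A x -> support_of A H (g x)) &
    (forall x y, A x -> A y -> g x = g y -> x = y).
  pose g x := if `[< support_of A H x >] then p (f 0, x) else p (f 1, h x).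
  have hX' x : A x -> ~ support_of A H x -> support_of A H (h x).
    by move=> Ax nXx; exact: hX.
  have gX x : A x -> support_of A H (g x).
    by rewrite /g; case: asboolP => [Xx _|nXx Ax]; apply: pX; split=> //=; exact: hX'.
  have sep n m x y : support_of A H x -> support_of A H y -> p (f n, x) = p (f m, y) ->
      n = m /\ x = y.
    by move=> Xx Xy /(pinj (f n, x) (f m, y) (conj (fX n) Xx) (conj (fX m) Xy))[/finj].
  exists g => // x y Ax Ay; rewrite /g; case: asboolP => Xx; case: asboolP => Xy.
  - by move=> /(sep _ _ _ _ Xx Xy)[].
  - by move=> /(sep _ _ _ _ Xx (hX' _ Ay Xy))[].
  - by move=> /(sep _ _ _ _ (hX' _ Ax Xx) Xy)[].
  - by move=> /(sep _ _ _ _ (hX' _ Ax Xx) (hX' _ Ay Xy))[_]; apply: hinj.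
apply: card_le_trans (card_le_trans XX _); last first.
  by apply: subset_card_le => x [].
apply: (card_le_rel (G := fun u v => v = (g u.1, g u.2))).
  by move=> [a b] [/= Aa Ab]; exists (g a, g b) => //; split; exact: gX.
move=> [a b] [a' b'] _ [/= Aa Ab] [/= Aa' Ab'] -> [/ginj -> // /ginj ->] //.
Qed.

(** Folding an injection of [A `*` A] into [A] along a sequence is injective
    on sequences of a given length; the length is coded separately. *)
Lemma card_seqX_le (S : eqType) (K : countType) (T : pointedType)
    (B : set S) (A : set T) : infinite_set A -> B #<= A ->
  [set sk : seq S * K | {in sk.1, forall x, B x}] #<= A.
Proof.
move=> Ainf /card_le_fun[g gA ginj].
have [q qA qinj] := card_le_fun (card_setX_infinite Ainf).
have [f fA finj] := card_le_fun ((infiniteP A).1 Ainf).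
have {}finj : injective f by move=> n m; exact: finj.
have {}fA n : A (f n) by exact: fA.
pose fold := foldr (fun x c => q (g x, c)) (f 0).
have foldA s : {in s, forall x, B x} -> A (fold s).
  elim: s => //= x s IHs Bs; apply: qA; split=> /=.
    by apply/gA/Bs/mem_head.
  by apply: IHs => y ys; apply: Bs; rewrite inE ys orbT.
have fold_inj s s' : {in s, forall x, B x} -> {in s', forall x, B x} ->
    size s = size s' -> fold s = fold s' -> s = s'.
  elim: s s' => [|x s IHs] [|x' s'] //= Bs Bs' [szs].
  have Bx : B x by apply/Bs/mem_head.
  have Bx' : B x' by apply/Bs'/mem_head.
  have {}Bs : {in s, forall x, B x} by move=> y ys; apply: Bs; rewrite inE ys orbT.
  have {}Bs' : {in s', forall x, B x} by move=> y ys; apply: Bs'; rewrite inE ys orbT.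
  move=> /(qinj (g x, fold s) (g x', fold s')
    (conj (gA _ Bx) (foldA _ Bs)) (conj (gA _ Bx') (foldA _ Bs'))).
  by move=> [/(ginj _ _ Bx Bx') -> /(IHs _ Bs Bs' szs) ->].
apply: (card_le_rel (G := fun sk c =>
  c = q (f (pickle (size sk.1, sk.2)), fold sk.1))) => [sk Bs|].
  exists (q (f (pickle (size sk.1, sk.2)), fold sk.1)) => //.
  by apply: qA; split; [exact: fA|exact: (foldA _ Bs)].
move=> [s k] [s' k'] _ /= Bs Bs' ->.
move=> /(qinj (_, _) (_, _) (conj (fA _) (foldA _ Bs)) (conj (fA _) (foldA _ Bs'))).
by move=> [/finj/(pcan_inj pickleK)[szs ->] /(fold_inj _ _ Bs Bs' szs) ->].
Qed.

Lemma uncountable_cantor_space : ~ countable [set: cantor_space].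
Proof.
move=> /card_le_fun[f _ finj].
pose x : cantor_space := fun n => `[< forall y : cantor_space, f y = n -> ~~ y n >].
have xx : ~~ x (f x).
  by apply/negP => xfx; have /asboolP/(_ x erefl)/negP := xfx.
have /asboolP[] := xx.
by move=> y /(finj _ _ I I) ->.
Qed.

(** * Well-orders and transfinite recursion *)

Lemma exists_well_founded_total (T : pointedType) : exists R : T -> T -> Prop,
  [/\ well_founded R, forall x y z, R x y -> R y z -> R x z &
      forall x y, x <> y -> R x y \/ R y x].
Proof.
have [le le_wo] := well_ordering_principle T.
have chainT : wo_chain le predT by move=> C _; exact: le_wo.
have le_total x y : le x y || le y x by exact: (wo_chainW chainT).
have le_refl x : le x x by rewrite -[le x x]orbb le_total.
have le_anti x y : le x y -> le y x -> x = y.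
  move=> xy yx; apply: (wo_chain_antisymmetric chainT) => //.
  by rewrite xy yx.
have least (S : set T) : S !=set0 -> exists2 z, S z & forall x, S x -> le z x.
  move=> [x Sx]; have [|z [[+ zmin] _]] := le_wo [pred x | `[< S x >]].
    by exists x; apply/asboolP.
  move=> /asboolP Sz; exists z => // y Sy.
  by apply: zmin; apply/asboolP.
have le_trans x y z : le x y -> le y z -> le x z.
  move=> xy yz; have [|w Sw wmin] := least [set t | [\/ t = x, t = y | t = z]].
    by exists x; constructor 1.
  case: Sw wmin => -> wmin; first by apply: wmin; constructor 3.
    by rewrite (le_anti x y xy (wmin x _)) //; constructor 1.
  by rewrite -(le_anti y z yz (wmin y _)) //; constructor 2.
exists (fun x y => le x y /\ x <> y); split.
- move=> x; apply: contrapT => nAx.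
  have [|z nAz zmin] := least [set t | ~ Acc (fun x y => le x y /\ x <> y) t].
    by exists x.
  apply: nAz; constructor => y [yz y_neq_z]; apply: contrapT => /zmin zy.
  exact/y_neq_z/le_anti.
- move=> x y z [xy nxy] [yz _]; split; first exact: le_trans yz.
  by move=> xz; apply: nxy; apply: le_anti => //; rewrite xz.
- move=> x y nxy; have /orP[xy|yx] := le_total x y; [left|right] => //.
  by split=> // yx'; apply: nxy.
Qed.

(** If some initial segment of a well-order of [T] is as large as [T], the least
    such segment is an isomorphic copy of the desired order. *)
Lemma exists_initial_well_order (T : pointedType) : exists R : T -> T -> Prop,
  [/\ well_founded R, forall x y z, R x y -> R y z -> R x z,
      forall x y, x <> y -> R x y \/ R y x &
      forall x, ~ ([set: T] #<= [set y | R y x])].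
Proof.
have [R [Rwf Rtrans Rtot]] := exists_well_founded_total T.
have [/existsNP[x0 /contrapT]|/contrapT small] :=
    pselect (~ forall x, ~ ([set: T] #<= [set y | R y x])); last by exists R.
elim/(well_founded_ind Rwf): x0 => x0 IH Tx0.
have [[y Ryx0 Ty]|small] :=
    pselect (exists2 y, R y x0 & [set: T] #<= [set z | R z y]); first exact: IH Ty.
have [g gx0 ginj] := card_le_fun Tx0.
exists (fun x y => R (g x) (g y)); split.
- move=> x; have: exists y, g x = y by exists (g x).
  move=> [y]; elim/(well_founded_ind Rwf): y x => y IHy x gxy.
  by constructor=> z Rzx; apply: (IHy (g z)) => //; rewrite -gxy.
- by move=> x y z; exact: Rtrans.
- by move=> x y nxy; apply: Rtot => /(ginj _ _ I I).
- move=> x Tx; apply: small; exists (g x); first exact: gx0.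
  apply: card_le_trans Tx _.
  apply: (card_le_rel (G := fun y z => z = g y)) => [y|y z w _ _ ->].
    by exists (g y).
  exact: ginj.
Qed.

Lemma wf_recursion T (Y : pointedType) (R : T -> T -> Prop)
    (step : T -> (T -> Y) -> Y) : well_founded R ->
  exists a : T -> Y,
    forall x, a x = step x (fun y => if `[< R y x >] then a y else point).
Proof.
move=> Rwf.
pose F x (rec : forall y, R y x -> Y) : Y :=
  step x (fun y => if pselect (R y x) is left Ryx then rec y Ryx else point).
exists (Fix Rwf (fun=> Y) F) => x; rewrite Fix_eq.
  rewrite {1}/F; congr step; apply/funext => y.
  by case: pselect => Ryx; case: asboolP.
move=> {}x r r' rr'; rewrite /F; congr step; apply/funext => y.
by case: pselect.
Qed.

(** * A countable independent family with two dense halves *)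

Definition stem := (seq bool * nat)%type.
Definition label := (bool * stem)%type.

(** The number [k] codes a finite set [P] of labels together with a padding
    that makes each [P] occur infinitely often; [k] is put exactly in the sets
    whose label is in [P].  The first values are overwritten by the prescribed
    initial segment, which makes each half of the family dense. *)
Definition indep_real (i : label) : cantor_space := fun k =>
  if k < size i.2.1 then nth false i.2.1 k
  else if @unpickle (seq label * nat)%type k is Some p then i \in p.1 else false.

Definition pattern (L P : seq label) (k : nat) : Prop :=
  {in L, forall i, indep_real i k = (i \in P)}.

Definition starts (s : seq bool) (y : cantor_space) : Prop :=
  forall n, n < size s -> y n = nth false s n.

Lemma indep_real_starts b s n : starts s (indep_real (b, (s, n))).
Proof. by move=> k ks; rewrite /indep_real /= ks. Qed.

Lemma leq_foldr_maxn (s : seq nat) : {in s, forall x, x <= foldr maxn 0 s}.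
Proof.
elim: s => //= x s IHs y; rewrite inE leq_max => /orP[/eqP->|/IHs ->].
  by rewrite leqnn.
by rewrite orbT.
Qed.

Lemma pattern_unbounded L P l : exists2 k, l <= k & pattern L P k.
Proof.
pose M := foldr maxn 0 [seq size i.2.1 | i <- L].
have [m Mm] := injective_gtn (f := fun m : nat => @pickle (seq label * nat)%type (P, m))
  (fun m m' => fun e => congr1 snd (pcan_inj pickleK e)) (l + M).
exists (pickle (P, m)); first exact: leq_trans (leq_addr _ _) (ltnW Mm).
move=> i iL; rewrite /indep_real pickleK ltnNge (leq_trans _ (ltnW Mm)) //=.
by apply: leq_trans (leq_addl _ _); apply: leq_foldr_maxn; apply/mapP; exists i.
Qed.

(** * Families independent over the fixed one *)

Section Families.
Variable S : eqType.
Implicit Types (B : set S) (a : S -> set nat) (u : set nat).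

Definition extends B a u : Prop := forall (s : seq S) L P l,
  {in s, forall t, B t} ->
  exists k, [/\ l <= k, {in s, forall t, a t k}, pattern L P k & u k].

Definition independent B a : Prop := extends B a setT.

(** A finite subfamily has a largest index, so independence can be checked one
    stage at a time. *)
Lemma independent_extends B a (R : S -> S -> Prop) :
  (forall x y z, R x y -> R y z -> R x z) ->
  (forall x y, x <> y -> R x y \/ R y x) ->
  (forall x, B x -> extends [set y | R y x] a (a x)) -> independent B a.
Proof.
move=> Rtrans Rtot ext s L P l Bs.
have [->|s0] := eqVneq s [::].
  by have [k lk Lk] := pattern_unbounded L P l; exists k.
have [x xs xmax] : exists2 x, x \in s & {in s, forall y, y <> x -> R y x}.
  elim: s s0 {Bs} => // x [|y s] IHs _.
    by exists x; rewrite ?mem_head// => y; rewrite inE => /eqP.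
  have [//|z zs zmax] := IHs.
  have [->|/eqP xz] := eqVneq x z.
    exists z; first exact: mem_head.
    by move=> t; rewrite inE => /orP[/eqP//|/zmax].
  have [Rxz|Rzx] := Rtot _ _ xz.
    exists z; first by rewrite inE zs orbT.
    by move=> t; rewrite inE => /orP[/eqP->//|/zmax].
  exists x; first exact: mem_head.
  move=> t; rewrite inE => /orP[/eqP//|/zmax Rt _].
  by have [->//|/eqP /Rt Rtz] := eqVneq t z; exact: Rtrans Rtz Rzx.
have [|k [lk sk Lk xk]] := ext x (Bs x xs) [seq y <- s | y != x] L P l.
  by move=> y; rewrite mem_filter => /andP[/eqP yx ys]; exact: xmax.
exists k; split=> // t ts; have [->//|tx] := eqVneq t x.
by apply: sk; rewrite mem_filter tx.
Qed.

Lemma eq_extends B a b u :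
  (forall t, B t -> a t = b t) -> extends B a u -> extends B b u.
Proof.
move=> ab ext s L P l Bs; have [k [lk sk Lk uk]] := ext s L P l Bs.
by exists k; split=> // t ts; rewrite -ab; [exact: sk|exact: Bs].
Qed.

End Families.

(** * Obstructing one homeomorphism *)

(** What a continuous injection of a space containing both halves of the family
    induces on indices, when it maps the first half into the second one. *)
Definition tame (phi : stem -> stem) : Prop :=
  injective phi /\ forall j k, exists m, forall j',
    (forall n, n < m -> indep_real (true, j') n = indep_real (true, j) n) ->
    indep_real (false, phi j') k = indep_real (false, phi j) k.

(** A filter containing such a [u] contains [x], and it cannot contain the limit
    at [x] of the map induced by [phi], because this limit is disjoint from
    [z]. *)
Definition obstructs (phi : stem -> stem) (u : set nat) : Prop :=
  exists x : cantor_space, exists z : set nat,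
    [/\ u `<=` [set n | x n], u `<=` z &
        forall k, z k -> exists m, forall j,
          (forall n, n < m -> indep_real (true, j) n = x n) ->
          indep_real (false, phi j) k = false].

(** An alias of [seq bool] that carries the order of Cohen forcing. *)
Definition cohen := seq bool.
HB.instance Definition _ := Countable.on cohen.

Definition cohen_le (s r : cohen) := prefix r s.

Fact cohen_le_refl : reflexive cohen_le. Proof. exact: prefix_refl. Qed.
Fact cohen_le_anti : antisymmetric cohen_le.
Proof.
move=> s r /andP[/prefixP[t ->] /prefixP[t']].
rewrite -catA -[LHS]cats0 => /eqP; rewrite eqseq_cat // eqxx /=.
by case: t => //; rewrite cats0.
Qed.
Fact cohen_le_trans : transitive cohen_le.
Proof. by move=> r s t rs tr; exact: prefix_trans tr rs. Qed.

HB.instance Definition _ := Order.Le_isPOrder.Build (Order.Disp tt tt) cohen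
  cohen_le_refl cohen_le_anti cohen_le_trans.

Lemma fresh_injective (f : nat -> nat) (Q1 Q2 : seq nat) : injective f ->
  exists n, n \notin Q1 /\ f n \notin Q2.
Proof.
move=> finj; pose M1 := foldr maxn 0 Q1; pose M2 := foldr maxn 0 Q2.
have [|m Mm] := injective_gtn (f := fun m => f (M1.+1 + m)) _ M2.
  by move=> m m' /finj/addnI.
exists (M1.+1 + m); split; apply/negP => /leq_foldr_maxn.
  by rewrite leqNgt addSn ltnS leq_addr.
by rewrite leqNgt Mm.
Qed.

(** The dense sets are fewer than continuum many: if [B] is countable then so is
    their index set, and otherwise the index set is no larger than [B]. *)
Lemma MA_small (MA : MA_countable) (d : Order.disp_t) (P : porderType d)
    (S : pointedType) (K : countType) (B : set S) (D : seq S * K -> set P) :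
  [set: P] !=set0 -> countable [set: P] ->
  ~ ([set: cantor_space] #<= B) ->
  (forall sk, {in sk.1, forall t, B t} -> order_dense (D sk)) ->
  exists2 G : set P, order_filter G &
    forall sk, {in sk.1, forall t, B t} -> G `&` D sk !=set0.
Proof.
move=> P0 Pcount Bsmall Ddense.
set Q := [set sk : seq S * K | {in sk.1, forall t, B t}].
have Qsmall : ~ ([set: cantor_space] #<= Q).
  move=> cQ; have [Bcount|Buncount] := pselect (countable B).
    apply: uncountable_cantor_space; apply: card_le_trans cQ _.
    by apply: card_seqX_le; [exact: infinite_nat|exact: Bcount].
  apply: Bsmall; apply: card_le_trans cQ _; apply: card_seqX_le => //.
  by move=> /finite_set_countable.
have DQ : D @` Q #<= Q by exact: card_image_le.
have [||G Gfil GD] := MA d P (D @` Q) P0 Pcount.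
- by move=> _ [sk Qsk <-]; exact: Ddense.
- have DQsmall : ~ ([set: cantor_space] #<= D @` Q).
    by move=> /card_le_trans/(_ DQ).
  split; first by have [] := card_le_total (D @` Q) [set: cantor_space].
  by rewrite card_eq_le => /andP[_].
- by exists G => // sk Qsk; apply: GD; exists sk.
Qed.

(** The generic real [x] is the union of the filter [G], and [z] collects the [k]
    that some condition in [G] keeps out of all images under [phi] of its
    extensions.  Genericity puts in both [x] and [z] arbitrarily large elements
    of each set that extensions of [a] have to meet. *)
Lemma MA_obstruction (MA : MA_countable) (S : pointedType) (B : set S)
    (a : S -> set nat) (phi : stem -> stem) :
  ~ ([set: cantor_space] #<= B) -> independent B a -> tame phi ->
  exists2 u, extends B a u & obstructs phi u.
Proof.
move=> Bsmall ind [phi_inj phi_cont].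
pose decides k (s : seq bool) := forall j,
  starts s (indep_real (true, j)) -> indep_real (false, phi j) k = false.
pose D (p : seq S * (seq label * seq label * nat)) : set cohen :=
  let: (s, (L, P, l)) := p in [set r | exists k,
    [/\ l <= k, {in s, forall t, a t k}, pattern L P k,
        (k < size r) && nth false r k & decides k r]].
have [||[s [[L P] l]] /= Bs|G Gfil GD] := MA_small MA (P := cohen) (D := D) _ _ Bsmall.
- by exists [::].
- exact: countableP.
- move=> r.
  have [|n [nL phinL]] := fresh_injective (f := fun n => pickle (phi (r, n)))
      [seq i.2.2 | i <- L] [seq pickle i.2 | i <- L].
    by move=> n n' /(pcan_inj pickleK)/phi_inj[].
  (* Neither the extension of [r] labelled by [j] nor its image occurs in [L], so
     that independence lets [k] be in the former and not in the latter. *)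
  set j : stem := (r, n) in nL phinL.
  have jL : (true, j) \notin L.
    by apply: contra nL => iL; apply/mapP; exists (true, j).
  have phijL : (false, phi j) \notin L.
    by apply: contra phinL => iL; apply/mapP; exists (false, phi j).
  have [k [lk sk Lk _]] := ind s ((true, j) :: (false, phi j) :: L)
    ((true, j) :: [seq i <- P | i \in L]) l Bs.
  have jk : indep_real (true, j) k.
    by rewrite Lk ?mem_head.
  have phijk : indep_real (false, phi j) k = false.
    rewrite Lk; last by rewrite !inE eqxx orbT.
    by rewrite inE mem_filter (negbTE phijL).
  have [m mcont] := phi_cont j k.
  pose N := maxn (size r) (maxn k.+1 m).
  exists (mkseq (indep_real (true, j)) N).
    exists k; split=> //.
    + move=> i iL; rewrite Lk ?inE ?iL ?orbT // mem_filter iL /=.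
      by case: eqP => // ij; rewrite -ij iL in jL.
    + have kN : k < N by rewrite /N !leq_max leqnn orbT.
      by rewrite size_mkseq kN nth_mkseq.
    + move=> j' j'r; rewrite (mcont j') // => i im.
      have iN : i < N by rewrite /N !leq_max im !orbT.
      by rewrite j'r ?size_mkseq // nth_mkseq.
  rewrite /Order.le /= /cohen_le prefixE.
  have rN : size r <= N by rewrite leq_max leqnn.
  have szr : size (take (size r) (mkseq (indep_real (true, j)) N)) = size r.
    by rewrite size_takel // size_mkseq.
  apply/eqP/(eq_from_nth (x0 := false)) => // i; rewrite szr => ir.
  rewrite nth_take // nth_mkseq; last exact: leq_trans ir rN.
  exact: indep_real_starts.
have coh r r' i : G r -> G r' -> i < size r -> i < size r' ->
    nth false r i = nth false r' i.
  move=> Gr Gr' ir ir'.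
  have [t Gt [/prefixP[v tr] /prefixP[v' tr']]] := order_filter_directed Gfil Gr Gr'.
  have := congr1 (nth false ^~ i) tr; rewrite {1}tr' /= !nth_cat ir ir'.
  by [].
pose x : cantor_space := fun n => `[< exists2 r, G r & (n < size r) && nth false r n >].
have xG r : G r -> starts r x.
  move=> Gr i ir; apply/idP/idP.
    by move=> /asboolP[r' Gr' /andP[ir' +]]; rewrite (coh r r').
  by move=> ri; apply/asboolP; exists r => //; rewrite ir.
pose z := [set k | exists2 r, G r & decides k r].
exists ([set n | x n] `&` z).
  move=> s L P l Bs; have [r [Gr [k [lk sk Lk rk dk]]]] := GD (s, (L, P, l)) Bs.
  exists k; split=> //; split; last by exists r.
  by apply/asboolP; exists r.
exists x, z; split=> [n []//|n []//|k [r Gr dk]].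
exists (size r) => j jx; apply: dk => i ir.
by rewrite jx //; exact: xG.
Qed.

(** * The recursion *)

(** The real [r] codes the graph of a function. *)
Lemma cantor_space_surj_fun (J K : countType) (k0 : K) :
  exists dec : cantor_space -> J -> K, forall phi, exists r, dec r = phi.
Proof.
exists (fun r j => xget k0 [set k | r (pickle (j, k))]) => phi.
exists (fun n => `[< exists j, n = pickle (j, phi j) >]).
apply/funext => j; apply: xget_subset1.
  by apply/asboolP; exists j.
have E k : `[< exists j', pickle (j, k) = pickle (j', phi j') >] -> k = phi j.
  by move=> /asboolP[j' /(pcan_inj pickleK)[-> ->]].
by move=> k k' /= /E -> /E ->.
Qed.

(** The stage [r] deals with the function coded by [r]; fewer than continuum
    many sets have been chosen before it. *)
Lemma exists_obstructing_family : MA_countable ->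
  exists a : cantor_space -> set nat, independent setT a /\
    forall phi, tame phi -> exists r, obstructs phi (a r).
Proof.
move=> MA.
have [dec dec_surj] := cantor_space_surj_fun stem (([::], 0) : stem).
have [R [Rwf Rtrans Rtot Rsmall]] := exists_initial_well_order cantor_space.
pose good r b u :=
  extends [set q | R q r] b u /\ (tame (dec r) -> obstructs (dec r) u).
have [a aE] := wf_recursion (fun r b => xget setT [set u | good r b u]) Rwf.
have a_good r : good r a (a r).
  elim/(well_founded_ind Rwf): r => r IH.
  have ind : independent [set q | R q r] a.
    by apply: independent_extends Rtrans Rtot _ => q /IH[].
  set b := fun q => if `[< R q r >] then a q else point.
  have ab q : R q r -> a q = b q by rewrite /b => /asboolT ->.
  have [u [ub uo]] : exists u, good r b u.
    have [tr|ntr] := pselect (tame (dec r)).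
      have [u ua uo] := MA_obstruction MA (Rsmall r) ind tr.
      by exists u; split=> //; exact: eq_extends ua.
    by exists setT; split=> //; exact: eq_extends ind.
  rewrite /good aE -/b; case: xgetP => [v _ [vb vo]|/(_ u)[]//].
  by split=> //; apply: eq_extends vb => q /ab.
exists a; split.
  by apply: independent_extends Rtrans Rtot _ => r _; have [] := a_good r.
move=> phi; have [r <-] := dec_surj phi => tr; exists r.
by have [_] := a_good r; apply.
Qed.

(** * The ultrafilter *)

Definition real_set (y : cantor_space) : set nat := [set n | y n].

Definition indep_sets : set_system nat := range (real_set \o indep_real).

(** The required sets generate a proper filter: given a finite intersection and
    a pseudointersection [v], take a label [i] outside the finite set [L]
    involved.  By independence the intersection is infinite outside the set
    labelled by [i], whereas [v] is finite there. *)
Lemma exists_ultrafilter (S : eqType) (a : S -> set nat) : independent setT a ->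
  exists U : set_system nat, [/\ UltraFilter U, forall t, U (a t),
    forall i, U (real_set (indep_real i)) &
    forall v, pseudointersection indep_sets v -> U (~` v)].
Proof.
move=> ind.
pose base (p : seq S * seq label * set nat) : set nat :=
  [set k | [/\ {in p.1.1, forall t, a t k},
    {in p.1.2, forall i, indep_real i k} & ~ p.2 k]].
pose dom := [set p : seq S * seq label * set nat | pseudointersection indep_sets p.2].
have pseudo0 : pseudointersection indep_sets set0.
  by move=> y _; rewrite /almost_subset set0D; exact: finite_set0.
have Ffil : ProperFilter (filter_from dom base).
  apply: filter_from_proper; last first.
    move=> [[s L] v] /= vpseudo.
    have [n nL] : exists n, n \notin [seq i.2.2 | i <- L].
      have [//|n [nL _]] := @fresh_injective id [seq i.2.2 | i <- L] [::].
      by exists n.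
    pose i : label := (true, ([::], n)).
    have iL : i \notin L by apply: contra nL => iL; apply/mapP; exists i.
    have /finite_seqP[q qE] : finite_set (v `\` real_set (indep_real i)).
      by apply: vpseudo; exists i.
    have [//|k [lk sk Lk _]] := ind s (i :: L) L (foldr maxn 0 q).+1.
    exists k; split=> //=.
      by move=> j jL; rewrite Lk // inE jL orbT.
    move=> vk; have : [set` q] k.
      rewrite -qE; split=> //; rewrite /real_set /= Lk ?mem_head //.
      exact/negP.
    by move=> /= /leq_foldr_maxn; rewrite leqNgt lk.
  apply: filter_from_filter; first by exists ([::], [::], set0).
  move=> [[s L] v] [[s' L'] v'] /= vp v'p; exists (s ++ s', L ++ L', v `|` v').
    move=> y Dy; rewrite /almost_subset setDUl finite_setU.
    by split; [exact: vp|exact: v'p].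
  move=> k [/= sk Lk vk]; split; split=> /= [t tq|t tq|vkq].
  - by apply: sk; rewrite mem_cat tq.
  - by apply: Lk; rewrite mem_cat tq.
  - by apply: vk; left.
  - by apply: sk; rewrite mem_cat tq orbT.
  - by apply: Lk; rewrite mem_cat tq orbT.
  - by apply: vk; right.
have [U [Uultra FU]] := ultraFilterLemma Ffil.
exists U; split=> // [t|i|v vp]; apply: FU.
- by exists ([:: t], [::], set0) => // k [/= + _ _]; apply; exact: mem_head.
- by exists ([::], [:: i], set0) => // k [/= _ + _]; apply; exact: mem_head.
- by exists ([::], [::], v) => // k [].
Qed.

Lemma not_P_point U : UltraFilter U -> (forall i, U (real_set (indep_real i))) ->
  (forall v, pseudointersection indep_sets v -> U (~` v)) -> ~ P_point U.
Proof.
move=> UU Ui Uv [_ _ /(_ indep_sets)[||v Uv' /Uv Uvc]].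
- by apply: card_le_trans (card_image_le _ _) _; exact: (@countableP label).
- by move=> _ [i _ <-]; exact: Ui.
- by apply: (@filter_not_empty _ U _); rewrite -(setICr v); exact: filterI.
Qed.

(** * Topology of subspaces of the Cantor space *)

Lemma open_cylinder (O : set cantor_space) (x : cantor_space) : open O -> O x ->
  exists m, forall y : cantor_space, (forall n, n < m -> y n = x n) -> O y.
Proof.
move=> Oo Ox; apply: contrapT => /forallNP noO.
have /choice[y yP] m : exists y : cantor_space, (forall n, n < m -> y n = x n) /\ ~ O y.
  by have /existsNP[y /not_implyP[]] := noO m; exists y.
have yx : y @ \oo --> x.
  apply/(@pointwise_cvgP nat bool) => n.
  by apply: cvg_near_cst; exists n.+1 => // m nm; apply: (yP m).1.
have : (y @ \oo) O by apply: yx; exact: open_nbhs_nbhs.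
move=> [N _ /(_ N)]; rewrite /= leqnn => /(_ isT).
by have [] := yP N.
Qed.

Lemma coord_continuous (U V : set_system nat) (f : char_funs U -> char_funs V)
    (p : char_funs U) (k : nat) : continuous f ->
  exists m, forall q : char_funs U,
    (forall n, n < m -> \val q n = \val p n) -> \val (f q) k = \val (f p) k.
Proof.
move=> fcont.
pose O := [set y : cantor_space | y k = \val (f p) k].
have Oo : open O.
  have pcont : continuous (fun y : cantor_space => y k).
    exact: (@proj_continuous nat (fun=> bool) k).
  apply: (open_comp (D := [set \val (f p) k])) => [y _|]; first exact: pcont.
  exact: discrete_open.
have vcont W : continuous (\val : char_funs W -> cantor_space).
  exact: initial_continuous.
have : open ((\val \o f) @^-1` O).
  by apply: open_comp => // q _; apply: continuous_comp; [exact: fcont|exact: vcont].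
move=> [O' O'o O'E].
have [|m mO'] := open_cylinder (x := \val p) O'o.
  have : (\val @^-1` O') p by rewrite O'E.
  by [].
exists m => q qp.
have : (\val @^-1` O') q by exact: mO'.
by rewrite O'E.
Qed.

Lemma indep_real_inj : injective indep_real.
Proof.
move=> i j ij; apply/eqP; rewrite eq_sym; apply/negPn/negP => neq.
have [k _ kP] := pattern_unbounded [:: i; j] [:: i] 0.
have := kP i (mem_head _ _); rewrite ij kP ?inE ?eqxx ?orbT //.
by rewrite (negbTE neq).
Qed.

(** * Failure of homogeneity *)

Lemma not_homogeneous (U : set_system nat) : ProperFilter U ->
  (forall i, U (real_set (indep_real i))) ->
  (forall phi, tame phi -> exists2 u, U u & obstructs phi u) ->
  ~ countable_dense_homogeneous (char_funs U).
Proof.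
move=> PU Ui Uobs cdh.
pose real i : char_funs U := SigSub (mem_set (Ui i : char_funs U (indep_real i))).
pose D b := range (fun j => real (b, j)).
have Dcount b : countable (D b).
  by apply: card_le_trans (card_image_le _ _) _; exact: (@countableP stem).
have Ddense b : dense (D b).
  move=> O [y Oy] [O' O'o O'E].
  have [|m mO'] := open_cylinder (x := \val y) O'o.
    by have : (\val @^-1` O') y by rewrite O'E.
  exists (real (b, (mkseq (\val y) m, 0))); split; last by exists (mkseq (\val y) m, 0).
  rewrite -O'E /=; apply: mO' => n nm.
  rewrite -[LHS]/(indep_real (b, (mkseq (\val y) m, 0)) n).
  by rewrite indep_real_starts ?size_mkseq // nth_mkseq.
have [f [fcont [g [_ fK _]]] fD] :=
  cdh _ _ (Dcount true) (Ddense true) (Dcount false) (Ddense false).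
have /choice[phi phiE] j : exists j', f (real (true, j)) = real (false, j').
  have : D false (f (real (true, j))).
    by rewrite -fD; exists (real (true, j)) => //; exists j.
  by move=> [j' _ <-]; exists j'.
have tphi : tame phi.
  split.
    move=> j j' jj'; have : real (true, j) = real (true, j').
      by apply: (can_inj fK); rewrite !phiE jj'.
    by move=> /(congr1 val) /indep_real_inj [].
  move=> j k; have [m mP] := coord_continuous (real (true, j)) k fcont.
  exists m => j' j'j; have := mP (real (true, j')) j'j.
  by rewrite !phiE.
(* The set [u] puts [x] and [z] in [U]; the images under [f] of points of the
   first half close to [x] agree with [f(x)] at [k] by continuity, and omit [k]
   because [k] is in [z]. *)
have [u Uu [x [z [ux uz zP]]]] := Uobs _ tphi.
have Ux : char_funs U x by exact: filterS Uu.
pose p : char_funs U := SigSub (mem_set Ux).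
have Ufp : U (real_set (\val (f p))) by exact: set_mem (valP (f p)).
have [k [zk fpk]] : z `&` real_set (\val (f p)) !=set0.
  by apply: (@filter_ex _ U); apply: filterI Ufp; exact: filterS uz Uu.
have [m1 m1P] := zP _ zk.
have [m2 m2P] := coord_continuous p k fcont.
pose m := maxn m1 m2; pose j : stem := (mkseq x m, 0).
have jx n : n < m -> indep_real (true, j) n = x n.
  by move=> nm; rewrite /j indep_real_starts ?size_mkseq // nth_mkseq.
have := m2P (real (true, j)); rewrite phiE /= m1P => [|n nm1]; last first.
  by apply: jx; rewrite leq_max nm1.
move: fpk; rewrite /real_set /= => -> H.
have : false = true; last by [].
by apply: H => n nm2; apply: jx; rewrite leq_max nm2 orbT.
Qed.

Theorem theorem43 : MA_countable ->
  exists U : set_system nat,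
    [/\ UltraFilter U, ~ P_point U &
        ~ countable_dense_homogeneous (char_funs U)].
Proof.
move=> MA; have [a [ind obs]] := exists_obstructing_family MA.
have [U [UU Ua Ui Uv]] := exists_ultrafilter ind.
exists U; split=> //; first exact: not_P_point.
apply: not_homogeneous => // phi /obs[r obs_r].
by exists (a r).
Qed.
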